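(* For each positive integer $n$, let $g(n)$ be the product of all prime powers at most $n$. Let $G$ be a non-trivial finite group such that $|G| = g(m)$, where $m = m(G)$ is the maximal order of an abelian subgroup of $G$. Then $m \in \{2,3,4,6\}$ and $G$ is isomorphic to $S_2$, $S_3$, $S_4$, $S_5$ respectively (that is, $G\cong S_2$ if $m=2$, $G\cong S_3$ if $m=3$, $G\cong S_4$ if $m=4$, and $G\cong S_5$ if $m=6$).
   Context: A prime power is an integer of the form $p^k$ with $p$ prime and $k \geq 1$; thus $g(n)=\prod_{p^k\le n,\ k\ge 1} p^k$, with $g(1)=1$. $S_n$ denotes the symmetric group of degree $n$. *)

(* Defs.v *)
From mathcomp Require Import all_boot all_fingroup.

Set Implicit Arguments.
Unset Strict Implicit.
Unset Printing Implicit Defensive.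

(* The bounds on p and k only serve decidability, see prime_powerP. *)
Definition prime_power (q : nat) : bool :=
  [exists p : 'I_q.+1, [exists k : 'I_q.+1,
    [&& prime p, 0 < k & q == p ^ k]]].

Lemma prime_powerP (q : nat) :
  reflect (exists p k, [/\ prime p, 0 < k & q = p ^ k]) (prime_power q).
Proof.
apply: (iffP existsP) => [[p /existsP[k /and3P[p_pr k_gt0 /eqP qE]]]|].
  by exists (val p), (val k).
case=> p [k [p_pr k_gt0 qE]].
have k_lt : k < q.+1 by rewrite qE ltnS ltnW // ltn_expl // prime_gt1.
have p_lt : p < q.+1.
  by rewrite qE ltnS -[leqLHS]expn1 leq_pexp2l // prime_gt0.
exists (Ordinal p_lt); apply/existsP; exists (Ordinal k_lt).
by rewrite /= p_pr k_gt0 {1}qE eqxx.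
Qed.

Definition prime_power_prod (n : nat) : nat :=
  \prod_(1 <= q < n.+1 | prime_power q) q.

Definition max_abelian_order (gT : finGroupType) (G : {group gT}) : nat :=
  \max_(A : {group gT} | (A \subset G) && abelian A) #|A|.

(* Main.v *)
Require Import Defs.
From mathcomp Require Import all_boot all_fingroup all_algebra all_solvable.
From mathcomp Require Import mxabelem.

(** Large abelian subgroups of 2-groups force m < 8; Sylow counting and actions
    on few points then determine G among the groups of the remaining orders.

    Bound on m.  Let 2 ^ k <= m < 2 ^ (k + 1).  The powers 2, 4, ..., 2 ^ k all
    occur in g(m), so a Sylow 2-subgroup P of G has order at least
    2 ^ (k (k + 1) / 2), while its abelian subgroups have order at most 2 ^ k.
    For k >= 3 this is impossible (two_group_large_abelian).  Indeed, adding to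
    an abelian subgroup Y of P an element w that is central modulo Y divides
    the order of the centralizer by at most #|Y|; starting from 1 this gives an
    abelian Y of order 2 ^ (k - 1) with centralizer R of order at least
    2 ^ (2 k - 1) (pgroup_abelian_series).  As no abelian subgroup exceeds
    2 ^ k, squares of elements of R lie in Y, so R / Y is elementary abelian;
    and each v in R outside Y has a centralizer of order at most 2 ^ k in R,
    so that [v, R] is all of Y.  Commutation is then an alternating bilinear
    map from F_2 ^ k to F_2 ^ (k - 1) all of whose partial maps at nonzero
    vectors are onto, that is, a (k - 1)-dimensional space of alternating forms
    in which only 0 is degenerate.  The Pfaffian of these forms has degree
    k / 2 < k - 1 in the k - 1 coordinates of the form, so by the
    Chevalley-Warning argument it vanishes at some nonzero form
    (alternating_degenerate_functional), a contradiction.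

    Remaining orders.  For m = 2 the order of G is 2.  For 3 <= m <= 7, pick a
    prime p with p <= m < 2 p and p ^ 2 not dividing #|G|.  A Sylow p-subgroup
    is its own centralizer, so #|G| = p d n with d dividing p - 1 and
    n = 1 mod p the number of Sylow p-subgroups, which determines n; when
    n > 1, the action of G on these n subgroups is faithful
    (self_centralizing_Sylow_faithful).
    For m = 3 and m = 4, taking p = 2 and p = 3 gives n = 3 and n = 4, and G is
    the full symmetric group of degree n.  For m = 7 and p = 5 no n exists.
    For m = 5 and m = 6 the order is 120 and p = 5 gives n = 6, so that G is a
    subgroup of index 6 in S_6; it acts faithfully on the 5 cosets other than
    itself, because A_6 is simple, whence G is S_5 (isog_Sn_index).  This rules
    out m = 5, as S_5 has an abelian subgroup of order 6. *)

Set Implicit Arguments.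
Unset Strict Implicit.
Unset Printing Implicit Defensive.

(** * Spaces of alternating forms over the field with two elements *)

Section AlternatingF2.

Import GRing.Theory.
Local Open Scope ring_scope.

Lemma F2_addxx (x : 'F_2) : x + x = 0.
Proof. by apply/eqP; move: x; case=> -[|[]]. Qed.

Lemma F2_mulxx (x : 'F_2) : x * x = x.
Proof. by apply/eqP; move: x; case=> -[|[]]. Qed.

Lemma F2_neq0 (x : 'F_2) : x != 0 -> x = 1.
Proof. by move=> x0; apply/eqP; move: x x0; case=> -[|[]]. Qed.

(** The terms at x and h x cancel in characteristic 2. *)
Lemma sum_invol_pairs (T : finType) (P : pred T) (h : T -> T) (F : T -> 'F_2) :
    involutive h -> (forall x, P (h x) = P x) -> (forall x, P x -> h x != x) ->
    (forall x, P x -> F (h x) = F x) ->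
  \sum_(x | P x) F x = 0.
Proof.
move=> hK hP h_neq hF.
rewrite (bigID (fun x => enum_rank x < enum_rank (h x))%N) /=.
rewrite [X in _ + X](reindex_inj (can_inj hK)) /=.
rewrite [X in _ + X](_ : _ =
    \sum_(x | P x && (enum_rank x < enum_rank (h x))%N) F x) ?F2_addxx //.
apply: eq_big => [x | x /andP[Px _]]; last by rewrite hF -1?hP.
rewrite hP hK; case Px: (P x) => //=; rewrite -leqNgt.
have := h_neq x Px; rewrite eq_sym -(inj_eq enum_rank_inj) -val_eqE /=.
by rewrite ltn_neqAle => ->.
Qed.

Definition fpf_invol n (s : 'S_n) :=
  (s == s^-1)%g && [forall i, s i != i].

(** The Leibniz terms of s and s^-1 agree for symmetric M, so only involutions
    survive, and those with a fixed point meet the zero diagonal.  In the term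
    of a fixed-point-free s each M i (s i) occurs twice, and squaring is the
    identity on F_2: what remains is the Pfaffian, a sum over perfect matchings
    of products of n / 2 entries. *)
Lemma det_alternating_F2 n (M : 'M['F_2]_n) :
    (forall i, M i i = 0) -> (forall i j, M i j = M j i) ->
  \det M =
    \sum_(s : 'S_n | fpf_invol s) \prod_(i : 'I_n | (i < s i)%N) M i (s i).
Proof.
move=> M0 Msym; rewrite /determinant.
rewrite (eq_bigr (fun s : 'S_n => \prod_i M i (s i))); last first.
  move=> s _; have -> : (-1 : 'F_2) = 1 by apply/eqP.
  by rewrite expr1n mul1r.
rewrite (bigID (fun s : 'S_n => (s == s^-1)%g)) /=.
rewrite [X in _ + X](@sum_invol_pairs _ _ (fun s => s^-1)%g) ?addr0; first last.
- move=> s _; rewrite (reindex_inj (@perm_inj _ s)) /=.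
  by apply: eq_bigr => i _; rewrite permK Msym.
- by move=> s; rewrite eq_sym.
- by move=> s; rewrite invgK eq_sym.
- exact: invgK.
rewrite (bigID (fun s : 'S_n => [forall i, s i != i])) /=.
rewrite [X in _ + X]big1 ?addr0; last first.
  move=> s /andP[_ /forallPn[i /negbNE/eqP si]].
  by rewrite (bigD1 i) //= si M0 mul0r.
apply: eq_bigr => s /andP[/eqP sV /forallP s_neq].
have sK i : s (s i) = i by rewrite {1}sV permK.
rewrite (bigID (fun i : 'I_n => i < s i)%N) /=.
rewrite [X in _ * X](_ : _ = \prod_(i : 'I_n | (i < s i)%N) M i (s i));
  first by rewrite F2_mulxx.
rewrite (reindex_inj (@perm_inj _ s)) /=.
apply: eq_big => [i | i _]; last by rewrite sK Msym.
by rewrite sK -leqNgt leq_eqVlt val_eqE eq_sym (negPf (s_neq i)).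
Qed.

Lemma card_fpf_invol_half n (s : 'S_n) :
  fpf_invol s -> (#|[pred i : 'I_n | i < s i]%N| <= n./2)%N.
Proof.
case/andP=> /eqP sV /forallP s_neq.
have sK i : s (s i) = i by rewrite {1}sV permK.
rewrite geq_half_double -addnn; set J := [pred i : 'I_n | _].
have Jn : (#|J| + #|[predC J]| = n)%N by rewrite cardC card_ord.
rewrite -[leqRHS]Jn leq_add2l.
rewrite -(card_image (@perm_inj _ s)); apply/subset_leq_card/subsetP=> j.
by case/imageP=> i ltis ->; rewrite !inE sK -leqNgt ltnW.
Qed.

(** Fewer than n linear forms in n variables have a common nonzero zero psi, and
    translation by psi pairs off the arguments c without changing the product.
    This is the Chevalley-Warning argument for products of linear forms. *)
Lemma sum_prod_linear_forms (I : finType) (J : pred I) n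
    (y : I -> 'rV['F_2]_n) : (#|J| < n)%N ->
  \sum_(c : 'cV['F_2]_n) \prod_(i | J i) (y i *m c) 0 0 = 0.
Proof.
move=> ltJn; pose Y := \matrix_(i < #|J|) y (enum_val i).
have [psi psi0 Ypsi]: exists2 psi : 'cV_n, psi != 0 & Y *m psi = 0.
  have: cokermx Y != 0.
    rewrite -mxrank_eq0 mxrank_coker subn_eq0 -ltnNge.
    exact: leq_ltn_trans (rank_leq_row Y) ltJn.
  case/matrix0Pn=> i [j Kij]; exists (col j (cokermx Y)).
    by apply/matrix0Pn; exists i, 0; rewrite mxE.
  by rewrite colE mulmxA mulmx_coker mul0mx.
have ypsi i : J i -> y i *m psi = 0.
  move=> Ji; have /(congr1 (row (enum_rank_in Ji i))) := Ypsi.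
  by rewrite row_mul rowK enum_rankK_in // => ->; rewrite row0.
apply: (@sum_invol_pairs _ _ (fun c => c + psi)) => //.
- move=> c; rewrite -addrA; have -> : psi + psi = 0; last exact: addr0.
  by apply/matrixP=> i j; rewrite !mxE F2_addxx.
- by move=> c _; rewrite -subr_eq0 addrC addKr.
by move=> c _; apply: eq_bigr => i Ji; rewrite mulmxDr ypsi // addr0.
Qed.

(** Some nonzero functional c makes the form u, v |-> b u v *m c degenerate:
    otherwise its determinant, which is the Pfaffian, would be 1 for each of the
    2 ^ n - 1 functionals c != 0, whereas the sum of the Pfaffians over all c is
    0 because their degree k / 2 is less than n. *)
Lemma alternating_degenerate_functional k n
    (b : 'rV['F_2]_k -> 'rV['F_2]_k -> 'rV['F_2]_n) :
    (forall u v w, b (u + v) w = b u w + b v w) ->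
    (forall u v w, b u (v + w) = b u v + b u w) ->
    (forall u, b u u = 0) -> (0 < k)%N -> (k./2 < n)%N ->
  exists2 c : 'cV_n, c != 0 &
  exists2 u : 'rV_k, u != 0 & forall w, b u w *m c = 0.
Proof.
move=> bDl bDr b0 k_gt0 ltkn.
have b_sym u v : b u v = b v u.
  have := b0 (u + v); rewrite bDl !bDr !b0 add0r addr0 => /eqP.
  rewrite addr_eq0 => /eqP->; apply/matrixP=> i j; rewrite mxE.
  by apply/eqP; rewrite eq_sym -addr_eq0 F2_addxx.
have F2_scale (V : lmodType 'F_2) (f : V -> 'rV['F_2]_n) a v :
    (forall x y, f (x + y) = f x + f y) -> f (a *: v) = a *: f v.
  move=> fD; have f0: f 0 = 0 by apply: (addrI (f 0)); rewrite -fD !addr0.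
  by have [-> | /F2_neq0->] := eqVneq a 0; rewrite ?scale0r ?scale1r.
pose e i : 'rV['F_2]_k := delta_mx 0 i.
pose M (c : 'cV_n) := \matrix_(i, j) (b (e i) (e j) *m c) 0 0.
have bM u c j : (b u (e j) *m c) 0 0 = (u *m M c) 0 j.
  have fD := bDl _ _ (e j).
  have f0 : b 0 (e j) = 0 by apply: (addrI (b 0 (e j))); rewrite -fD !addr0.
  rewrite [u in LHS]row_sum_delta.
  rewrite (big_morph (b^~ (e j)) (fun x y => fD x y) f0).
  rewrite mulmx_suml summxE mxE; apply: eq_bigr => i _.
  by rewrite (F2_scale _ (b^~ (e j))) // -scalemxAl !mxE.
have [/existsP[c /andP[c0 /det0P[u u0 uM]]] | /existsPn detM] :=
    boolP [exists c : 'cV_n, (c != 0) && (\det (M c) == 0)].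
  exists c => //; exists u => // w; apply/rowP=> i0; rewrite ord1 [RHS]mxE.
  have fD := bDr u.
  have f0 : b u 0 = 0 by apply: (addrI (b u 0)); rewrite -fD !addr0.
  rewrite [w]row_sum_delta (big_morph (b u) (fun x y => fD x y) f0).
  rewrite mulmx_suml summxE big1 // => j _.
  by rewrite (F2_scale _ (b u)) // -scalemxAl mxE bM uM !mxE mulr0.
have: \sum_c \det (M c) = 0.
  transitivity (\sum_(c : 'cV_n) \sum_(s : 'S_k | fpf_invol s)
      \prod_(i : 'I_k | (i < s i)%N) (b (e i) (e (s i)) *m c) 0 0).
    apply: eq_bigr => c _; rewrite det_alternating_F2.
    - apply: eq_bigr => s _; apply: eq_bigr => i _; exact: mxE.
    - by move=> i; rewrite mxE b0 mul0mx mxE.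
    - by move=> i j; rewrite !mxE b_sym.
  rewrite exchange_big big1 //= => s /card_fpf_invol_half leJ.
  exact: sum_prod_linear_forms (leq_ltn_trans leJ ltkn).
rewrite (bigD1 0) //= (_ : \det (M 0) = 0) ?add0r; last first.
  apply/eqP/det0P; exists (e (Ordinal k_gt0)).
    by apply/matrix0Pn; exists 0, (Ordinal k_gt0); rewrite !mxE !eqxx oner_eq0.
  rewrite (_ : M 0 = 0) ?mulmx0 //.
  by apply/matrixP=> i j; rewrite !mxE; apply: big1 => l _; rewrite mxE mulr0.
rewrite (eq_bigr (fun=> 1)) => [|c c0]; last first.
  by apply: F2_neq0; have := detM c; rewrite c0.
rewrite sumr_const; have := cardC1 (0 : 'cV['F_2]_n).
rewrite card_mx muln1 card_Fp // => cardC.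
have -> : #|[pred c : 'cV['F_2]_n | c != 0]| = (2 ^ n).-1.
  by rewrite -cardC; apply: eq_card.
have n_gt0 : (0 < n)%N by apply: leq_ltn_trans ltkn.
suff -> : (2 ^ n).-1%:R = 1 :> 'F_2 by move/eqP; rewrite oner_eq0.
rewrite -(prednK n_gt0); move: n.-1 => d.
rewrite expnS mul2n -addnn; case: (2 ^ d)%N (expn_gt0 2 d) => [|q] //= _.
by rewrite addnS mulrS mulrnDr F2_addxx addr0.
Qed.

End AlternatingF2.

(** * Conjugacy classes in 2-groups of class two *)

Section SmallClass.

Variable gT : finGroupType.
Implicit Types R Y : {group gT}.
Local Open Scope group_scope.

Lemma commMg_central R Y x y z : Y \subset 'Z(R) -> [~: R, R] \subset Y ->
  x \in R -> y \in R -> z \in R -> [~ x * y, z] = [~ x, z] * [~ y, z].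
Proof.
move=> sYZ sR'Y Rx Ry Rz; rewrite commMgJ conjgE.
have /(subsetP sYZ)/centerP[_ /(_ y Ry)->] : [~ x, z] \in Y.
  by apply: (subsetP sR'Y); apply: mem_commg.
by rewrite mulKg.
Qed.

Lemma commgM_central R Y x y z : Y \subset 'Z(R) -> [~: R, R] \subset Y ->
  x \in R -> y \in R -> z \in R -> [~ z, x * y] = [~ z, x] * [~ z, y].
Proof.
move=> sYZ sR'Y Rx Ry Rz.
rewrite -[LHS]invgR (commMg_central sYZ) // invMg !invgR.
have /(subsetP sYZ)/centerP[_] : [~ z, y] \in Y.
  by apply: (subsetP sR'Y); apply: mem_commg.
by apply; rewrite groupR.
Qed.

Lemma comm_coset_central R Y x y z : Y \subset 'Z(R) -> [~: R, R] \subset Y ->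
  x \in R -> y \in R -> z \in R -> coset Y x = coset Y y -> [~ x, z] = [~ y, z].
Proof.
move=> sYZ sR'Y Rx Ry Rz eqxy.
have sYR := subset_trans sYZ (center_sub R).
have nYR : R \subset 'N(Y) by rewrite sub_der1_norm.
have /rcosetP[t Yt ->] : x \in Y :* y.
  by apply/rcoset_kercosetP => //; apply: (subsetP nYR).
rewrite (commMg_central sYZ) ?(subsetP sYR t) //.
have /commgP/eqP-> : commute t z.
  by case/centerP: (subsetP sYZ _ Yt) => _; apply.
by rewrite mul1g.
Qed.

(** Commutation induces an alternating bilinear map from R / Y to Y.  A vector u
    in the radical of the form given by a nonzero functional c lifts to an
    element v with [v, R] contained in the kernel of c on Y, and v ^: R is a
    translate of [v, R]. *)
Lemma small_class_elem R Y k n :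
    Y \subset 'Z(R) -> 2.-abelem Y -> 2.-abelem (R / Y) ->
    #|R / Y| = (2 ^ k)%N -> #|Y| = (2 ^ n)%N -> 0 < k -> k./2 < n ->
  exists2 v, v \in R :\: Y & #|v ^: R| < #|Y|.
Proof.
move=> sYZ abelY abelRY cardRY cardY k_gt0 lt_kn.
have sYR := subset_trans sYZ (center_sub R).
have nsYR : Y <| R by rewrite sub_center_normal.
have sR'Y : [~: R, R] \subset Y.
  by rewrite der1_min ?normal_norm ?(abelem_abelian abelRY).
have ntRY : R / Y != 1 by rewrite -cardG_gt1 cardRY -[1%N]/(2 ^ 0)%N ltn_exp2l.
have ntY : Y :!=: 1.
  rewrite -cardG_gt1 cardY -[1%N]/(2 ^ 0)%N ltn_exp2l //.
  exact: leq_ltn_trans lt_kn.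
pose r x := repr (rVabelem abelRY ntRY x).
have rK x : coset Y (r x) = rVabelem abelRY ntRY x by apply: coset_reprK.
have rR x : r x \in R.
  rewrite -(quotientGK nsYR) mem_morphpre ?repr_coset_norm //=.
  by rewrite rK mem_rVabelem.
pose b x y := abelem_rV abelY ntY [~ r x, r y].
have YR x y : x \in R -> y \in R -> [~ x, y] \in Y.
  by move=> Rx Ry; apply: (subsetP sR'Y); apply: mem_commg.
have nYR := subsetP (normal_norm nsYR).
have rD x y : coset Y (r (x + y)%R) = coset Y (r x * r y).
  by rewrite morphM ?nYR //= !rK rVabelemD.
have b_xx u : b u u = 0%R by rewrite /b commgg abelem_rV_1.
have bDl u v w : b (u + v)%R w = (b u w + b v w)%R.
  rewrite /b (comm_coset_central sYZ _ _ _ _ (rD u v)) ?groupM //.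
  by rewrite (commMg_central sYZ) // abelem_rV_M ?YR.
have bDr u v w : b u (v + w)%R = (b u v + b u w)%R.
  rewrite /b -invgR (comm_coset_central sYZ _ _ _ _ (rD v w)) ?groupM // invgR.
  by rewrite (commgM_central sYZ) // abelem_rV_M ?YR.
have dimRY : 'dim (R / Y) = k.
  apply/eqP; rewrite -(@eqn_exp2l 2) // -cardRY.
  by rewrite -(card_abelem_rV abelRY ntRY) card_mx mul1n card_Fp.
have dimY : 'dim Y = n.
  apply/eqP; rewrite -(@eqn_exp2l 2) // -cardY.
  by rewrite -(card_abelem_rV abelY ntY) card_mx mul1n card_Fp.
have [||c c0 [u u0 bc]] := alternating_degenerate_functional bDl bDr b_xx.
- by rewrite dimRY.
- by rewrite dimRY dimY.
exists (r u).
  rewrite inE rR andbT; apply: contra u0 => Yru.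
  rewrite -(inj_eq (@rVabelem_inj _ _ _ abelRY ntRY)) -rK rVabelem0.
  by rewrite coset_id.
pose M := [set y in Y | abelem_rV abelY ntY y *m c == 0]%R.
have ltMY : #|M| < #|Y|.
  apply/proper_card/properP; split; first by apply/subsetP=> y /[!inE]/andP[].
  have [i [j cij]] := matrix0Pn _ c0.
  exists (rVabelem abelY ntY (delta_mx 0%R i)); first exact: mem_rVabelem.
  rewrite inE mem_rVabelem rVabelemK -rowE; apply: contra cij.
  by move/eqP/rowP/(_ j); rewrite !mxE => ->.
apply: leq_ltn_trans ltMY; rewrite -(card_lcoset M (r u)).
apply/subset_leq_card/subsetP=> _ /imsetP[x Rx ->].
rewrite mem_lcoset inE -/([~ r u, x]) YR //=.
have -> : [~ r u, x] = [~ r u, r (abelem_rV abelRY ntRY (coset Y x))].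
  rewrite -invgR -[RHS]invgR; congr _^-1.
  apply: (comm_coset_central sYZ) => //.
  by rewrite rK abelem_rV_K ?mem_quotient.
exact/eqP/bc.
Qed.

End SmallClass.

(** * Large abelian subgroups of 2-groups *)

Section LargeAbelian.

Variable gT : finGroupType.
Implicit Types A C P R Y : {group gT}.
Local Open Scope group_scope.

(** Such a w is a lift of an element of order p of the centre of C / Y: all its
    conjugates lie in the coset w *: Y, so there are at most #|Y| of them. *)
Lemma central_extension_step p C Y : prime p -> p.-group C ->
    Y \subset 'Z(C) -> Y \proper C ->
  exists w, [/\ w \in C, #|Y <*> <[w]>| = (p * #|Y|)%N
              & #|C| <= #|'C_C[w]| * #|Y|].
Proof.
move=> p_pr pC sYZ prYC.
have nsYC : Y <| C by rewrite sub_center_normal.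
have [sYC nYC] := andP nsYC.
have ntCY : C / Y != 1 by rewrite -subG1 quotient_sub1 // proper_subn.
have pCY : p.-group (C / Y) by apply: quotient_pgroup.
have ntZ : 'Z(C / Y) != 1.
  by apply: contra ntCY => /eqP/(trivg_center_pgroup pCY)/eqP.
have [_ p_dv _] := pgroup_pdiv (pgroupS (center_sub _) pCY) ntZ.
have [x /centerP[CYx cx] ox] := Cauchy p_pr p_dv.
have /morphimP[w nYw Cw def_x] := CYx; exists w; split=> //.
  have sYw : Y \subset Y <*> <[w]> by apply: joing_subl.
  rewrite -(Lagrange sYw) mulnC -card_quotient ?join_subG ?normG ?cycle_subG //.
  by rewrite quotientYidl ?cycle_subG // quotient_cycle // -orderE -ox def_x.
rewrite -(Lagrange (subcent1_sub w C)) leq_pmul2l // index_cent1.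
rewrite -(card_lcoset Y w); apply/subset_leq_card/subsetP=> _ /imsetP[z Cz ->].
rewrite mem_lcoset -/([~ w, z]); have nYz := subsetP nYC z Cz.
apply: coset_idr; first by rewrite groupR.
rewrite morphR //=; apply/eqP/commgP.
by rewrite -[coset Y w]def_x; apply: cx; rewrite mem_quotient.
Qed.

Lemma abelian_join_cycle A w :
  abelian A -> w \in 'C(A) -> abelian (A <*> <[w]>).
Proof. by move=> abA cAw; rewrite abelianY abA cycle_abelian cycle_subG. Qed.

(** Enlarging an abelian group of order p ^ j by central_extension_step divides
    the order of its centralizer by at most p ^ j, and the exponents
    0, 1, ..., i - 1 add up to 'C(i, 2). *)
Lemma pgroup_abelian_series p P N i : prime p -> p.-group P ->
    #|P| = (p ^ N)%N -> 'C(i, 2) < N ->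
  exists Y, [/\ Y \subset P, abelian Y, #|Y| = (p ^ i)%N
              & (p ^ N)%N <= #|'C_P(Y)| * p ^ 'C(i, 2)].
Proof.
move=> p_pr pP cardP; elim: i => [|i IHi] ltN.
  exists 1%G; rewrite sub1G abelian1 cards1 cent1T setIT bin0n muln1 cardP.
  by split.
have ltN' : 'C(i, 2) < N by apply: leq_ltn_trans ltN; rewrite binS leq_addr.
have {IHi} [Y [sYP abY cardY leC]] := IHi ltN'.
pose C := 'C_P(Y)%G.
have sYC : Y \subset C by rewrite subsetI sYP.
have sYZ : Y \subset 'Z(C) by rewrite subsetI sYC centsC subsetIr.
have prYC : Y \proper C.
  rewrite properEcard sYC cardY /=.
  rewrite -(@ltn_pmul2r (p ^ 'C(i, 2))) ?expn_gt0 ?prime_gt0 //.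
  apply: leq_trans leC; rewrite -expnD ltn_exp2l ?prime_gt1 //.
  by move: ltN; rewrite binS bin1 addnC.
have [w [Cw cardZ leCw]] :=
  central_extension_step p_pr (pgroupS (subsetIl _ _) pP) sYZ prYC.
have [Pw cYw] := setIP Cw.
exists (Y <*> <[w]>)%G; split.
- by rewrite join_subG sYP cycle_subG.
- exact: abelian_join_cycle.
- by rewrite cardZ cardY expnS.
have pC_gt0 : 0 < p ^ 'C(i, 2) by rewrite expn_gt0 prime_gt0.
apply: leq_trans leC _; rewrite binS bin1 expnD mulnA mulnAC leq_pmul2r //.
by rewrite -cardY centY cent_cycle setIA.
Qed.

(** Assuming abelian subgroups of order at most 2 ^ k, the centralizer R of an
    abelian subgroup Y of order 2 ^ (k - 1) has order at least 2 ^ (2 k - 1),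
    and the smallness of the subgroups <Y, v> and <Y, v, u> forces R / Y and Y
    to be elementary abelian and every class of R outside Y to have at least
    #|Y| elements, against small_class_elem.  In the proof k is n + 1. *)
Lemma two_group_large_abelian P k : 2.-group P -> 2 < k ->
    2 ^ 'C(k.+1, 2) %| #|P| ->
  exists A, [/\ A \subset P, abelian A & (2 ^ k)%N < #|A|].
Proof.
case: k => // n pP n_gt1 dvP.
suff: [exists A : {group gT},
         [&& A \subset P, abelian A & (2 ^ n.+1)%N < #|A|]].
  by case/existsP=> A /and3P[]; exists A.
apply: contraT => noA.
have smallA A : A \subset P -> abelian A -> #|A| <= (2 ^ n.+1)%N.
  move=> sAP abA; rewrite leqNgt; apply: contra noA => ltkA.
  by apply/existsP; exists A; rewrite sAP abA.
have [N cardP] : exists N, #|P| = (2 ^ N)%N.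
  by exists (logn 2 #|P|); apply: card_pgroup.
have leN : 'C(n.+2, 2) <= N.
  by rewrite -(@dvdn_Pexp2l 2) // -cardP.
have defC : 'C(n.+2, 2) = ('C(n, 2) + (n + n.+1))%N.
  by rewrite binS bin1 binS bin1 -addnA.
have [|Y [sYP abY cardY leR]] := @pgroup_abelian_series 2 P N n isT pP cardP.
  by apply: leq_trans leN; rewrite defC !addnS ltnS leq_addr.
pose R := 'C_P(Y)%G.
have sRP : R \subset P by apply: subsetIl.
have sYR : Y \subset R by rewrite subsetI sYP.
have sYZ : Y \subset 'Z(R) by rewrite subsetI sYR centsC subsetIr.
have nsYR : Y <| R by rewrite sub_center_normal.
have nYR := subsetP (normal_norm nsYR).
have pR := pgroupS sRP pP.
have geR : 2 ^ (n + n.+1) <= #|R|.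
  rewrite -(@leq_pmul2r (2 ^ 'C(n, 2))) ?expn_gt0 //.
  by apply: leq_trans leR; rewrite -expnD leq_exp2l // addnC -defC.
have cardY2 : (2 * #|Y|)%N = (2 ^ n.+1)%N.
  by rewrite cardY expnS.
have Rabel v : v \in R -> abelian (Y <*> <[v]>) /\ (Y <*> <[v]> \subset P).
  move=> Rv; have [Pv cYv] := setIP Rv.
  by rewrite join_subG sYP cycle_subG; split=> //; apply: abelian_join_cycle.
have sqY v : v \in R -> v ^+ 2 \in Y.
  move=> Rv; have [abZ sZP] := Rabel v Rv; have := smallA _ sZP abZ.
  have sYZ' : Y \subset Y <*> <[v]> by apply: joing_subl.
  rewrite -cardY2 -(Lagrange sYZ') mulnC leq_pmul2r //.
  rewrite -card_quotient ?join_subG ?normG ?cycle_subG ?nYR //.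
  rewrite quotientYidl ?cycle_subG ?nYR // quotient_cycle ?nYR // => le2.
  apply: coset_idr; first by rewrite groupX ?nYR.
  rewrite morphX ?nYR //; apply/eqP; rewrite -order_dvdn /order.
  by case: #|_| (cardG_gt0 <[coset Y v]>) le2 => [|[|[]]].
have abelRY : 2.-abelem (R / Y).
  apply/exponent2_abelem/exponentP=> _ /morphimP[v nYv Rv ->].
  by rewrite -morphX //= coset_id ?sqY.
(* An element u of 'C_R[v] outside <Y, v> would make <Y, v, u> abelian of order
   at least 4 #|Y|, which is 2 ^ n.+2. *)
have cent_small v : v \in R :\: Y -> #|'C_R[v]| <= (2 ^ n.+1)%N.
  case/setDP=> Rv nYv; have [abZ sZP] := Rabel v Rv.
  rewrite leqNgt; apply/negP=> ltZ.
  have [u Cu nZu] : exists2 u, u \in 'C_R[v] & u \notin Y <*> <[v]>.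
    apply/subsetPn; apply: contraL ltZ => /subset_leq_card leC.
    by rewrite -leqNgt (leq_trans leC) ?smallA.
  have [Ru cvu] := setIP Cu; have [Pu cYu] := setIP Ru.
  have cZu : u \in 'C(Y <*> <[v]>) by rewrite centY inE cYu cent_cycle.
  have abZu := abelian_join_cycle abZ cZu.
  have := smallA (Y <*> <[v]> <*> <[u]>)%G; rewrite join_subG sZP cycle_subG Pu.
  move/(_ isT abZu); apply/negP; rewrite -ltnNge -cardY2.
  have prYZ : Y \proper Y <*> <[v]>.
    by rewrite properE joing_subl join_subG cycle_subG (negPf nYv) andbF.
  have prZU : Y <*> <[v]> \proper Y <*> <[v]> <*> <[u]>.
    by rewrite properE joing_subl join_subG cycle_subG (negPf nZu) andbF.
  apply: leq_ltn_trans (proper_card prZU).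
  rewrite -(Lagrange (proper_sub prYZ)) mulnC leq_pmul2l //.
  by rewrite indexg_gt1 proper_subn.
have class_big v : v \in R :\: Y -> #|Y| <= #|v ^: R|.
  move=> RYv; have := cent_small v RYv; have := geR.
  rewrite -(Lagrange (subcent1_sub v R)) index_cent1 addnC expnD -cardY.
  have C_gt0 : 0 < #|'C_R[v]| by apply: cardG_gt0.
  move=> le1 le2; rewrite -(leq_pmul2l C_gt0); apply: leq_trans le1.
  by rewrite leq_mul2r le2 orbT.
have sR'Y : [~: R, R] \subset Y.
  by rewrite der1_min ?normal_norm ?(abelem_abelian abelRY).
have ltYR : #|Y| < #|R|.
  by apply: leq_trans geR; rewrite cardY ltn_exp2l // addnS ltnS leq_addr.
have [v RYv] : exists v, v \in R :\: Y.
  apply/set0Pn; rewrite setD_eq0; apply: contraL ltYR => /subset_leq_card.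
  by rewrite -leqNgt.
have [Rv nYv] := setDP RYv.
have sclass : v ^: R \subset v *: Y.
  apply/subsetP=> _ /imsetP[z Rz ->]; rewrite mem_lcoset -/([~ v, z]).
  by apply: (subsetP sR'Y); apply: mem_commg.
(* The classes fill whole cosets of Y, so every element of Y is a commutator
   [v, z], whose square is [v ^ 2, z] = 1. *)
have abelY : 2.-abelem Y.
  apply/exponent2_abelem/exponentP=> y Yy.
  have: v * y \in v ^: R.
    have /eqP-> : v ^: R == v *: Y.
      by rewrite eqEcard sclass card_lcoset class_big.
    by rewrite mem_lcoset mulKg.
  case/imsetP=> z Rz /(canRL (mulKg v)) ->; rewrite -/([~ v, z]).
  rewrite expgS expg1 -(commMg_central sYZ) // -[v * v]/(v ^+ 2).
  by apply/eqP/commgP; case/centerP: (subsetP sYZ _ (sqY v Rv)) => _; apply.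
have cardRY : #|R / Y| <= (2 ^ n.+1)%N.
  rewrite card_quotient ?normal_norm // -(leq_pmul2l (cardG_gt0 Y)) Lagrange //.
  rewrite -(Lagrange (subcent1_sub v R)) index_cent1 mulnC.
  rewrite leq_mul ?cent_small //.
  by rewrite -(card_lcoset Y v) subset_leq_card.
have [k' cardRY'] : exists k', #|R / Y| = (2 ^ k')%N.
  by exists (logn 2 #|R / Y|); apply/card_pgroup/quotient_pgroup.
have lek' : k' <= n.+1 by rewrite -(@leq_exp2l 2) // -cardRY'.
have k'_gt0 : 0 < k'.
  rewrite -(@ltn_exp2l 2) // -cardRY' cardG_gt1 -subG1.
  rewrite quotient_sub1 ?normal_norm //.
  by apply/subsetPn; exists v.
have [//||u RYu] := small_class_elem sYZ abelY abelRY cardRY' cardY.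
  apply: leq_ltn_trans (half_leq lek') _; rewrite ltn_half_double.
  by rewrite -addnn -addn1 ltn_add2l.
by rewrite ltnNge class_big.
Qed.

End LargeAbelian.

(** * Self-centralizing Sylow subgroups of prime order *)

Section SelfCentralizingSylow.

Variable gT : finGroupType.
Implicit Types A G K P : {group gT}.
Local Open Scope group_scope.

(** An element x of the centralizer outside P would generate with P an abelian
    group of order a proper multiple of p. *)
Lemma self_centralizing_of_order p G P : P \subset G -> #|P| = p -> prime p ->
    (forall A, A \subset G -> abelian A -> #|A| < 2 * p) ->
  'C_G(P) = P.
Proof.
move=> sPG oP p_pr smallA.
have abP : abelian P by rewrite cyclic_abelian ?prime_cyclic ?oP.
apply/eqP; rewrite eqEsubset; apply/andP; split; last by rewrite subsetI sPG.
apply/subsetP=> x /setIP[Gx cPx]; apply: contraLR isT => nPx.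
have := smallA (P <*> <[x]>)%G; rewrite join_subG sPG cycle_subG Gx /=.
move=> /(_ isT (abelian_join_cycle abP cPx)); rewrite ltnNge => /negP[].
have sPX : P \subset P <*> <[x]> by apply: joing_subl.
rewrite -(Lagrange sPX) oP mulnC leq_mul // indexg_gt1.
by rewrite join_subG subxx cycle_subG.
Qed.

(** The quotient embeds in Aut P, of order p - 1. *)
Lemma index_cent_prime p G P : prime p -> #|P| = p -> G \subset 'N(P) ->
  #|G : 'C_G(P)| %| p.-1.
Proof.
move=> p_pr oP nPG; have cycP : cyclic P by rewrite prime_cyclic ?oP.
rewrite -totient_prime // -oP -card_Aut_cyclic // -card_quotient; last first.
  by rewrite normsI ?normG // norms_cent.
rewrite /= -ker_conj_aut (card_isog (first_isog_loc _ nPG)).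
exact/cardSg/Aut_conj_aut.
Qed.

Lemma card_self_centralizing_Sylow p G P : prime p -> p.-Sylow(G) P ->
    #|P| = p -> 'C_G(P) = P ->
  exists2 d, d %| p.-1 & #|G| = (p * d * #|'Syl_p(G)|)%N.
Proof.
move=> p_pr sylP oP cPP; have sPG := pHall_sub sylP.
have cNP : 'C_('N_G(P))(P) = P by rewrite -setIA (setIidPr (cent_sub P)).
have nPN : 'N_G(P) \subset 'N(P) by apply: subsetIr.
exists #|'N_G(P) : P|; first by rewrite -{2}cNP index_cent_prime.
rewrite (card_Syl sylP) -{1}oP Lagrange ?Lagrange ?subsetIl //.
by rewrite subsetI sPG normG.
Qed.

(** The kernel K of the action normalizes P.  If K meets P trivially, then
    [K, P] = 1 and K lies in 'C_G(P) = P.  If K contains P, then P is the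
    normal Sylow p-subgroup of K, hence normal in G.  A centre of G that is
    not trivial would likewise equal P. *)
Lemma self_centralizing_Sylow_faithful p G P : prime p -> p.-Sylow(G) P ->
    #|P| = p -> 'C_G(P) = P -> ~~ (P <| G) ->
  'C_G('Syl_p(G) | 'JG) = 1 /\ 'Z(G) = 1.
Proof.
move=> p_pr sylP oP cPP nnP; have sPG := pHall_sub sylP.
have TI A : P :&: A = 1 \/ P \subset A.
  have [sPA | nsPA] := boolP (P \subset A); [by right | left].
  by apply: prime_TIg; rewrite ?oP.
split; last first.
  have sZP : 'Z(G) \subset P by rewrite -cPP setIS // centS.
  have [tiZ | sPZ] := TI 'Z(G)%G; first by rewrite -(setIidPr sZP).
  case/negP: nnP; have -> : P :=: 'Z(G) by apply/eqP; rewrite eqEsubset sPZ.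
  exact: center_normal.
set K := 'C_G('Syl_p(G) | 'JG).
have nsKG : K <| G.
  exact: normalGI (atrans_acts (Syl_trans p G)) (astab_normal _ _).
have SylP : P \in 'Syl_p(G) by rewrite inE.
have nPK : K \subset 'N(P).
  apply/subsetP=> x /setIP[_ /astabP/(_ P SylP) xP].
  by apply/normP; rewrite -{2}xP.
have [tiPK | sPK] := TI K.
  apply/trivgP; rewrite -tiPK subsetI subxx andbT -cPP subsetI subsetIl.
  apply/commG1P/trivgP; rewrite -tiPK setIC subsetI commg_subl commg_subr nPK.
  by rewrite (subset_trans sPG) ?normal_norm.
case/negP: nnP; rewrite -(normal_Hall_pcore (H := P) (G := K) (pi := p)).
- by apply: char_normal_trans nsKG; apply: pcore_char.
- by apply: pHall_subl sylP; rewrite ?subsetIl.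
- by rewrite /normal sPK.
Qed.

End SelfCentralizingSylow.

(** * Groups acting on few points *)

Section SymmetricEmbeddings.

Local Open Scope group_scope.

Lemma faithful_isog_sub_Sn (aT : finGroupType) (rT : finType)
    (to : {action aT &-> rT}) (G : {group aT}) (S : {set rT}) n :
    [acts G, on S | to] -> 'C_G(S | to) = 1 -> #|S| = n ->
  exists H : {group 'S_n}, G \isog H.
Proof.
move=> actsG faithG <-.
pose e (i : 'I_#|S|) : rT := enum_val i.
pose moves g (s : 'S_#|S|) := [forall i, e (s i) == to (e i) g].
(* The default value 1 only serves elements g outside G. *)
pose phi g := odflt 1 [pick s | moves g s].
have phiP g i : g \in G -> e (phi g i) = to (e i) g.
  move=> Gg; rewrite /phi; case: pickP => [s /forallP/(_ i)/eqP // | noS].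
  have Se j : to (e j) g \in S by rewrite (acts_act actsG) // enum_valP.
  pose f j := enum_rank_in (Se j) (to (e j) g).
  have ef j : e (f j) = to (e j) g by apply: enum_rankK_in.
  have f_inj : injective f.
    move=> j1 j2 /(congr1 e); rewrite !ef => /act_inj. exact: enum_val_inj.
  by have /forallP[j] := noS (perm f_inj); rewrite permE ef.
have phiM : {in G &, {morph phi : x y / x * y}}.
  move=> x y Gx Gy; apply/permP=> i; apply: enum_val_inj.
  by rewrite -!/(e _) permM !phiP ?groupM // actM.
pose f := Morphism phiM.
exists (f @* G)%G; apply/isogP; exists f => //.
apply/injmP=> x y Gx Gy eq_xy; apply/eqP.
rewrite eq_mulgV1 -in_set1 -[[set 1]]faithG.
rewrite inE groupM ?groupV //; apply/astabP=> u Su.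
have <- : e (enum_rank_in Su u) = u by rewrite /e enum_rankK_in.
by rewrite actM -phiP // [phi x]eq_xy phiP // actK.
Qed.

Lemma faithful_isog_Sn (aT : finGroupType) (rT : finType)
    (to : {action aT &-> rT}) (G : {group aT}) (S : {set rT}) n :
    [acts G, on S | to] -> 'C_G(S | to) = 1 -> #|S| = n -> #|G| = n`! ->
  G \isog [set: 'S_n].
Proof.
move=> actsG faithG cardS cardG.
have [H isoGH] := faithful_isog_sub_Sn actsG faithG cardS.
suff <- : H :=: [set: 'S_n] by [].
apply/eqP; rewrite eqEcard subsetT cardsT card_Sn -(card_isog isoGH).
by rewrite cardG /=.
Qed.

Lemma normal_order2_central (gT : finGroupType) (G K : {group gT}) :
  K <| G -> #|K| = 2 -> K \subset 'Z(G).
Proof.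
case/andP=> sKG nKG oK; rewrite subsetI sKG centsC /=.
have := index_cent_prime (isT : prime 2) oK nKG.
by rewrite dvdn1 indexg_eq1 subsetI subxx.
Qed.

(** By simplicity, K meets the alternating group trivially or contains it; the
    order bound leaves the first case, and the alternating group has index 2. *)
Lemma normal_Sn_small n (K : {group 'S_n}) :
  4 < n -> K <| [set: 'S_n] -> #|K|.*2 < n`! -> #|K| <= 2.
Proof.
move=> n_gt4 nsK ltK; set A := 'Alt_('I_n)%G.
have n_gt1 : 1 < #|'I_n| by rewrite card_ord; apply: leq_trans n_gt4.
have /simpleP[_ simA] : simple A by apply: simple_Alt5; rewrite card_ord.
have oA : (2 * #|A|)%N = n`! by rewrite card_Alt // card_ord.
have [tiAK | defA] := simA (A :&: K)%G (normalGI (subsetT A) nsK).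
  have := cardSg (subsetT (A <*> K)).
  rewrite /= norm_joinEr ?(subset_trans (subsetT K) (Alt_norm _)) //.
  rewrite TI_cardMg //.
  rewrite cardsT card_Sn -oA mulnC dvdn_pmul2r //; exact: dvdn_leq.
have /subset_leq_card : A \subset K by apply/setIidPl; exact: defA.
by rewrite leqNgt -(@ltn_pmul2l 2) // oA mul2n ltK.
Qed.

(** H acts on the n cosets other than H itself.  Elements acting trivially lie
    in the core of H, a normal subgroup of S_(n + 1) of order at most n!, hence
    of order at most 2, hence central in H.  For n = 5 and a transitive H this
    is the construction behind the exotic automorphism of S_6. *)
Lemma isog_Sn_index n (H : {group 'S_n.+1}) :
  3 < n -> #|H| = n`! -> 'Z(H) = 1 -> H \isog [set: 'S_n].
Proof.
move=> n_gt3 oH Z1; pose S := rcosets H [set: 'S_n.+1].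
have iH : #|S| = n.+1.
  apply/eqP; rewrite -(eqn_pmul2l (cardG_gt0 H)) Lagrange ?subsetT //.
  by rewrite cardsT card_Sn factS mulnC oH.
have SH : gval H \in S.
  by apply/rcosetsP; exists 1; rewrite ?rcoset1 ?mulg1 ?group1 // inE.
have actsS : [acts H, on S | 'Rs].
  exact: subset_trans (subsetT H) (actsRs_rcosets _ _).
have fixH x : x \in H -> 'Rs%act (gval H) x = H.
  by move=> Hx; rewrite /= rcosetE rcoset_id.
have cardK : #|gcore H [set: 'S_n.+1]| <= 2.
  apply: normal_Sn_small => //; first by apply: gcore_normal; exact: subsetT.
  apply: leq_ltn_trans (_ : (n`!).*2 < _).
    by rewrite leq_double -oH subset_leq_card ?gcore_sub.
  by rewrite factS -mul2n ltn_pmul2r ?fact_gt0 // ltnS (leq_trans _ n_gt3).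
have K1 : gcore H [set: 'S_n.+1] = 1.
  move: cardK; rewrite leq_eqVlt => /predU1P[oK|]; last exact: card_le1_trivg.
  apply/trivgP; rewrite -Z1; apply: normal_order2_central oK.
  by apply: normalS (gcore_normal (subsetT H)); rewrite ?gcore_sub ?subsetT.
apply: (@faithful_isog_Sn _ _ 'Rs H (S :\ gval H)) => //.
- apply/actsP=> x Hx u; rewrite !inE (acts_act actsS) //.
  by rewrite -{1}(fixH x Hx) (inj_eq (act_inj _ _)).
- apply/trivgP; rewrite -K1 -(astabRs_rcosets H [set: 'S_n.+1]).
  apply/subsetP=> x /setIP[Hx /astabP fixx]; apply/astabP=> u Su.
  have [-> | nuH] := eqVneq u H; first exact: fixH.
  by apply: fixx; rewrite !inE nuH.
by move: iH; rewrite (cardsD1 (gval H)) SH => -[].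
Qed.

End SymmetricEmbeddings.

(** * The products of prime powers *)

Section PrimePowerProducts.

Lemma prime_power_pX p k : prime p -> 0 < k -> prime_power (p ^ k).
Proof. by move=> p_pr k_gt0; apply/prime_powerP; exists p, k. Qed.

Lemma prime_power_prod0 : prime_power_prod 0 = 1.
Proof. by rewrite /prime_power_prod big_nil. Qed.

Lemma prime_power_prodS n : prime_power_prod n.+1 =
  (prime_power_prod n * (if prime_power n.+1 then n.+1 else 1))%N.
Proof.
by rewrite /prime_power_prod big_mkcond big_nat_recr //= -big_mkcond.
Qed.

Lemma prime_power_prod_dvd m n :
  m <= n -> prime_power_prod m %| prime_power_prod n.
Proof.
elim: n => [|n IHn]; first by rewrite leqn0 => /eqP->.
rewrite leq_eqVlt => /predU1P[-> // | /IHn]; rewrite prime_power_prodS.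
exact: dvdn_mulr.
Qed.

(** The exponents of the factors p, p ^ 2, ..., p ^ k add up to 'C(k + 1, 2). *)
Lemma prime_power_prod_part p k n : prime p -> p ^ k <= n ->
  p ^ 'C(k.+1, 2) %| prime_power_prod n.
Proof.
move=> p_pr le_pk_n; apply: dvdn_trans (prime_power_prod_dvd le_pk_n).
elim: k {n le_pk_n} => // k IHk.
have pk1_gt0 : 0 < p ^ k.+1 by rewrite expn_gt0 prime_gt0.
rewrite -(prednK pk1_gt0) prime_power_prodS prednK // prime_power_pX //.
rewrite binS bin1 expnD dvdn_mul // (dvdn_trans IHk) // prime_power_prod_dvd //.
by rewrite -ltnS prednK // ltn_exp2l ?prime_gt1.
Qed.

Lemma prime_power_small :
  [/\ ~~ prime_power 1, prime_power 2, prime_power 3 & prime_power 4] /\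
  [/\ prime_power 5, ~~ prime_power 6 & prime_power 7].
Proof.
split; split; try exact: (@prime_power_pX _ 1).
- apply/negP=> /prime_powerP[p [[|k] [p_pr // _ def1]]].
  by have := ltn_expl k.+1 (prime_gt1 p_pr); rewrite -def1.
- exact: (@prime_power_pX 2 2).
apply/negP=> /prime_powerP[p [k [p_pr _ def6]]].
have p_eq q : prime q -> q %| 6 -> q = p.
  by move=> q_pr; rewrite def6 Euclid_dvdX // dvdn_prime2 // => /andP[/eqP].
by have := p_eq 3 isT isT; rewrite -(p_eq 2).
Qed.

Lemma prime_power_prod_small :
  [/\ prime_power_prod 1 = 1, prime_power_prod 2 = 2, prime_power_prod 3 = 6
    & prime_power_prod 4 = 24] /\
  [/\ prime_power_prod 5 = 120, prime_power_prod 6 = 120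
    & prime_power_prod 7 = 840].
Proof.
have [[n1 p2 p3 p4] [p5 n6 p7]] := prime_power_small.
by rewrite !prime_power_prodS prime_power_prod0 p2 p3 p4 p5 p7
  (negPf n1) (negPf n6).
Qed.

End PrimePowerProducts.

(** * The classification *)

Section Classification.

Local Open Scope group_scope.

Lemma abelian_leq_max (gT : finGroupType) (G A : {group gT}) :
  A \subset G -> abelian A -> #|A| <= max_abelian_order G.
Proof.
move=> sAG abA; rewrite /max_abelian_order.
by apply: (@leq_bigmax_cond _ _ (fun A : {group gT} => #|A|)); rewrite sAG.
Qed.

Lemma max_abelian_order_lt8 (gT : finGroupType) (G : {group gT}) :
  #|G| = prime_power_prod (max_abelian_order G) -> max_abelian_order G < 8.
Proof.
set m := max_abelian_order G => cardG; rewrite ltnNge; apply/negP=> m_ge8.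
have m_gt0 : 0 < m by apply: leq_trans m_ge8.
pose k := trunc_log 2 m.
have /andP[le_k_m lt_m_k] := trunc_log_bounds (isT : 1 < 2) m_gt0.
have k_gt2 : 2 < k by apply: trunc_log_max.
have [P sylP] := Sylow_exists 2 G; have pP := pHall_pgroup sylP.
have dvP : 2 ^ 'C(k.+1, 2) %| #|P|.
  rewrite (card_Hall sylP) p_part dvdn_exp2l // -pfactor_dvdn // cardG.
  exact: prime_power_prod_part.
have [A [sAP abA ltA]] := two_group_large_abelian pP k_gt2 dvP.
have := abelian_leq_max (subset_trans sAP (pHall_sub sylP)) abA.
rewrite -/m leqNgt => /negP[]; apply: leq_trans lt_m_k _.
rewrite (card_pgroup (pgroupS sAP pP)) in ltA *.
by rewrite leq_exp2l // -(@ltn_exp2l 2).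
Qed.

(** The premise on divisors says that Sylow's congruence admits at most the
    value n for the number of Sylow p-subgroups; it is decided by computation
    once #|G| and p are numerals.  With n = 0 it says that no value is
    admissible. *)
Lemma card_Syl_unique (gT : finGroupType) (G P : {group gT}) p n :
    prime p -> p.-Sylow(G) P -> #|P| = p -> 'C_G(P) = P ->
    all (fun d => (#|G| %/ (p * d) == 1 %[mod p]) ==> (#|G| %/ (p * d) == n))
      (divisors p.-1) ->
  #|'Syl_p(G)| = n.
Proof.
move=> p_pr sylP oP cPP /allP unique_n.
have [d dv_d oG] := card_self_centralizing_Sylow p_pr sylP oP cPP.
have p1_gt0 : 0 < p.-1 by rewrite -ltnS prednK ?prime_gt0 ?prime_gt1.
have pd_gt0 : 0 < p * d by rewrite muln_gt0 prime_gt0 // (dvdn_gt0 p1_gt0 dv_d).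
have := unique_n d; rewrite -dvdn_divisors // dv_d oG mulKn //.
by rewrite card_Syl_mod // modn_small ?prime_gt1 // eqxx => /(_ isT)/eqP.
Qed.

Lemma Syl_action (gT : finGroupType) (G : {group gT}) p n :
    prime p -> logn p #|G| = 1%N ->
    (forall A : {group gT}, A \subset G -> abelian A -> #|A| < 2 * p) ->
    all (fun d => (#|G| %/ (p * d) == 1 %[mod p]) ==> (#|G| %/ (p * d) == n))
      (divisors p.-1) ->
  #|'Syl_p(G)| = n
  /\ (n != 1%N -> 'C_G('Syl_p(G) | 'JG) = 1 /\ 'Z(G) = 1).
Proof.
move=> p_pr lognG smallA unique_n; have [P sylP] := Sylow_exists p G.
have oP : #|P| = p by rewrite (card_Hall sylP) p_part lognG.
have cPP := self_centralizing_of_order (pHall_sub sylP) oP p_pr smallA.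
have oSyl := card_Syl_unique p_pr sylP oP cPP unique_n.
split=> // n_neq1; apply: self_centralizing_Sylow_faithful oP cPP _ => //.
apply: contra n_neq1 => nsPG; rewrite -oSyl; apply/normal_sylowP.
by exists P.
Qed.

(** The subgroup generated by (0 1) and a 3-cycle on {2, 3, 4}. *)
Lemma S5_abelian6 : exists2 A : {group 'S_5}, abelian A & 5 < #|A|.
Proof.
pose i (k : nat) : 'I_5 := inord k.
pose x := tperm (i 0) (i 1%N); pose y := tperm (i 2) (i 3) * tperm (i 3) (i 4).
have eqi j k : j < 5 -> k < 5 -> (i j == i k) = (j == k).
  by move=> lt_j lt_k; rewrite -val_eqE /= !inordK.
have allI (P : 'I_5 -> Prop) :
    P (i 0) -> P (i 1%N) -> P (i 2) -> P (i 3) -> P (i 4) -> forall j, P j.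
  move=> P0 P1 P2 P3 P4 j; rewrite -[j]inord_val.
  by case: j => [[|[|[|[|[|]]]]] ?].
have cxy : commute x y.
  by apply/permP; apply: allI; rewrite !permE /= !permE /= !permE /= !eqi.
have x2 : x ^+ 2 = 1 by exact: tperm2.
have x_neq1 : x != 1.
  by apply/eqP=> /permP/(_ (i 0))/eqP; rewrite tpermL perm1 eqi.
have y3 : y ^+ 3 = 1.
  rewrite !expgS expg0 mulg1; apply/permP; apply: allI;
    rewrite !permM perm1; do 6! rewrite ?permE /= ?eqi //=.
have y_neq1 : y != 1.
  by apply/eqP=> /permP/(_ (i 2))/eqP; rewrite permM tpermL tpermL perm1 eqi.
have ox : #[x] = 2 by apply: nt_prime_order.
have oy : #[y] = 3 by apply: nt_prime_order.
exists (<[x]> <*> <[y]>)%G.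
  by rewrite abelianY !cycle_abelian cycle_subG /= cent_cycle; exact/cent1P.
apply: dvdn_leq; first exact: cardG_gt0.
rewrite (@Gauss_dvd 2 3) // -[X in X %| _]ox -[X in _ && (X %| _)]oy.
by rewrite !cardSg ?joing_subl ?joing_subr.
Qed.

Lemma classification_lt8 (gT : finGroupType) (G : {group gT}) m :
    #|G| = prime_power_prod m -> m < 8 ->
    (forall A : {group gT}, A \subset G -> abelian A -> #|A| <= m) ->
    G :!=: 1 ->
  m \in [:: 2; 3; 4; 6] /\
  [/\ m = 2 -> G \isog [set: 'S_2], m = 3 -> G \isog [set: 'S_3],
      m = 4 -> G \isog [set: 'S_4] & m = 6 -> G \isog [set: 'S_5]].
Proof.
have [[g1 g2 g3 g4] [g5 g6 g7]] := prime_power_prod_small.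
move=> cardG lt_m8 smallA ntG.
have symS p n : prime p -> logn p #|G| = 1%N -> m < 2 * p -> n != 1%N ->
    all (fun d => (#|G| %/ (p * d) == 1 %[mod p]) ==> (#|G| %/ (p * d) == n))
      (divisors p.-1) ->
  [/\ [acts G, on 'Syl_p(G) | 'JG], #|'Syl_p(G)| = n,
      'C_G('Syl_p(G) | 'JG) = 1 & 'Z(G) = 1].
  move=> p_pr lognG lt_m n_neq1 unique_n.
  have [| oSyl /(_ n_neq1)[? ?]] := Syl_action p_pr lognG _ unique_n.
    by move=> A sAG abA; apply: leq_ltn_trans (smallA A sAG abA) lt_m.
  by split=> //; apply/atrans_acts/Syl_trans.
have S5 : #|G| = 120 -> m < 10 -> G \isog [set: 'S_5].
  move=> oG lt_m10; case: (symS 5 6); rewrite ?oG // => acts5 o5 C5 Z5.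
  have [H isoGH] := faithful_isog_sub_Sn acts5 C5 o5.
  apply: (isog_trans isoGH); apply: isog_Sn_index => //.
    by rewrite -(card_isog isoGH).
  by apply: card1_trivg; rewrite -(card_isog (isog_center isoGH)) /= Z5 cards1.
case: m => [|[|[|[|[|[|[|[|]]]]]]]] // in cardG lt_m8 smallA symS S5 *.
- by case/eqP: ntG; apply: card1_trivg; rewrite cardG prime_power_prod0.
- by case/eqP: ntG; apply: card1_trivg; rewrite cardG g1.
- split=> //; split=> // _.
  have oS2 : #|[set: 'S_2]| = 2 by rewrite cardsT card_Sn.
  by rewrite isog_cyclic_card ?prime_cyclic ?oS2 ?cardG ?g2.
- split=> //; split=> // _; rewrite g3 in cardG.
  case: (symS 2 3); rewrite ?cardG // => a o C _.
  exact: faithful_isog_Sn a C o cardG.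
- split=> //; split=> // _; rewrite g4 in cardG.
  case: (symS 3 4); rewrite ?cardG // => a o C _.
  exact: faithful_isog_Sn a C o cardG.
- rewrite g5 in cardG; have /isogP[f injf imf] := isog_symr (S5 cardG isT).
  (* Here m = 5, and S_5 contradicts the bound on abelian subgroups. *)
  have [A abA ltA] := S5_abelian6.
  have sfAG : f @* A \subset G by rewrite -imf morphimS ?subsetT.
  have := smallA (f @* A)%G sfAG (morphim_abelian f abA).
  by rewrite card_injm ?subsetT // leqNgt ltA.
- by split=> //; split=> // _; apply: S5; rewrite ?cardG.
rewrite g7 in cardG; case: (symS 5 0); rewrite ?cardG // => _ o _ _.
by have := card_Syl_mod G (isT : prime 5); rewrite o.
Qed.

End Classification.

Theorem corollary3p4 (gT : finGroupType) (G : {group gT}) (m : nat)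
    (G_nontrivial : G :!=: 1%g)
    (mE : m = max_abelian_order G)
    (cardG : #|G| = prime_power_prod m) :
  m \in [:: 2; 3; 4; 6] /\
  [/\ m = 2 -> G \isog [set: 'S_2],
      m = 3 -> G \isog [set: 'S_3],
      m = 4 -> G \isog [set: 'S_4]
    & m = 6 -> G \isog [set: 'S_5]].
Proof.
apply: classification_lt8 => //; rewrite mE; last exact: abelian_leq_max.
by apply: max_abelian_order_lt8; rewrite -mE.
Qed.
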